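(* Let $l^{(1)}(t)$ and $u^{(1)}(t)$ be functions such that $0<l^{(1)}(t)\le m^{(1)}_{\lambda}(t)\le u^{(1)}(t)$ for all $\lambda\ge 1$ and any $t$. Let $\psi:(0,\infty)\to(0,\infty)$ and let $\delta_{\psi}(\mathbf{X})=\psi(D)X_1$ be a scale equivariant estimator of $\theta_1$. Let $\psi_{1,0}:(0,\infty)\to(0,\infty)$ be such that $\psi(t)<\psi_{1,0}(t)\le\frac{1}{u^{(1)}(t)}$ whenever $\psi(t)<\frac{1}{u^{(1)}(t)}$; $\frac{1}{l^{(1)}(t)}\le\psi_{1,0}(t)<\psi(t)$ whenever $\frac{1}{l^{(1)}(t)}<\psi(t)$; and $\psi_{1,0}(t)=\psi(t)$ whenever $\frac{1}{u^{(1)}(t)}\le\psi(t)\le\frac{1}{l^{(1)}(t)}$. If $P_{\boldsymbol\theta}\left[\frac{1}{u^{(1)}(D)}\le\psi(D)\le\frac{1}{l^{(1)}(D)}\right]<1$ for all $\boldsymbol\theta\in\Theta_0$, then, under the GPN criterion with a general loss function, the estimator $\delta_{\psi_{1,0}}(\mathbf{X})=\psi_{1,0}(D)X_1$ is nearer to $\theta_1$ than $\delta_{\psi}(\mathbf{X})=\psi(D)X_1$.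
   Context: $f$ is a specified Lebesgue probability density, and $\mathbf{X}=(X_1,X_2)$ has joint p.d.f. $\frac{1}{\theta_1\theta_2}f\left(\frac{x_1}{\theta_1},\frac{x_2}{\theta_2}\right)$, where $\boldsymbol\theta=(\theta_1,\theta_2)\in\Theta_0=\{(t_1,t_2)\in(0,\infty)^2:t_1\le t_2\}$ is unknown; the support of $\mathbf{X}$ is assumed to be a subset of $(0,\infty)^2$. Put $\lambda=\theta_2/\theta_1\ge1$, $D=X_2/X_1$, $Z_1=X_1/\theta_1$. The p.d.f. of $D$ is $f_D(t|\lambda)=\int_0^\infty\frac{y}{\lambda}f\left(y,\frac{yt}{\lambda}\right)dy$, and the conditional p.d.f. of $Z_1$ given $D=t$ is $f_\lambda(s|t)=\frac{s}{\lambda}f\left(s,\frac{st}{\lambda}\right)/f_D(t|\lambda)$ ($t$ in the support of $D$). $m^{(1)}_\lambda(t)$ denotes the median of this conditional distribution, so $\int_0^{m^{(1)}_\lambda(t)}sf(s,\frac{st}{\lambda})\,ds=\frac12\int_0^\infty sf(s,\frac{st}{\lambda})\,ds$. General loss function: $L_1(\boldsymbol\theta,a)=W(a/\theta_1)$, $a\in(0,\infty)$, where $W:(0,\infty)\to[0,\infty)$ satisfies $W(1)=0$, $W$ strictly decreasing on $(0,1)$ and strictly increasing on $(1,\infty)$. GPN criterion: for estimators $\delta_1,\delta_2$ of $\theta_1$, $GPN(\delta_1,\delta_2;\boldsymbol\theta)=P_{\boldsymbol\theta}[L_1(\boldsymbol\theta,\delta_1)<L_1(\boldsymbol\theta,\delta_2)]+\frac12P_{\boldsymbol\theta}[L_1(\boldsymbol\theta,\delta_1)=L_1(\boldsymbol\theta,\delta_2)]$.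 $\delta_1$ is nearer to $\theta_1$ than $\delta_2$ if $GPN(\delta_1,\delta_2;\boldsymbol\theta)\ge\frac12$ for all $\boldsymbol\theta\in\Theta_0$, with strict inequality for some $\boldsymbol\theta\in\Theta_0$. All functions defining estimators are understood to be Borel measurable.
   Formalization: The loss function W is additionally assumed continuous at 1; without this the strict inequality in ''nearer'' can fail for every θ (e.g. W(t)=1−t for t≤1, W(t)=5+t for t>1). The bounds l ≤ m ≤ u are required of every median of the conditional law. *)

(* Defs.v *)
From HB Require Import structures.
From mathcomp Require Import all_boot all_order all_algebra.
From mathcomp Require Import all_classical all_reals all_analysis.
Import Order.TTheory GRing.Theory Num.Theory.
Import numFieldNormedType.Exports.

Set Implicit Arguments.
Unset Strict Implicit.
Unset Printing Implicit Defensive.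

Local Open Scope classical_set_scope.
Local Open Scope ring_scope.
Local Open Scope ereal_scope.

Definition is_density2 (R : realType) (f : R * R -> R) : Prop :=
  [/\ measurable_fun [set: R * R] f,
      (forall x, (0 <= f x)%R) &
      \int[@lebesgue_measure R \x @lebesgue_measure R]_x (f x)%:E = 1].

(* Order-restricted parameter space; theta = (theta_1, theta_2). *)
Definition Theta0 (R : realType) : set (R * R) :=
  [set theta | (0 < theta.1)%R /\ (theta.1 <= theta.2)%R].

Definition scale_pdf (R : realType) (f : R * R -> R) (theta x : R * R) : R :=
  ((theta.1 * theta.2)^-1 * f (x.1 / theta.1, x.2 / theta.2))%R.

(* Under each P theta with theta in Theta0, X has p.d.f. scale_pdf f theta.
   The support condition is read as: the sample space of X is (0, oo)^2, which
   is where estimators built from functions on (0, oo) are defined.  It forces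
   f to vanish almost everywhere outside the open quadrant. *)
Definition scale_model (R : realType) (d : measure_display)
    (Omega : measurableType d) (f : R * R -> R)
    (P : R * R -> probability Omega R) (X : {mfun Omega >-> (R * R)%type}) :
    Prop :=
  [/\ is_density2 f,
      (forall w, (0 < (X w).1)%R /\ (0 < (X w).2)%R) &
      forall theta, Theta0 theta ->
        forall A : set (R * R), measurable A ->
          distribution (P theta) X A =
          \int[@lebesgue_measure R \x @lebesgue_measure R]_(x in A)
             (scale_pdf f theta x)%:E].

(* f_D(t | lambda), the p.d.f. of D = X_2 / X_1. *)
Definition pdf_D (R : realType) (f : R * R -> R) (lambda t : R) : \bar R :=
  \int[@lebesgue_measure R]_(y in `]0%R, +oo[)
    (y / lambda * f (y, (y * t / lambda)%R))%:E.

(* f_lambda(s | t), the p.d.f. of Z_1 = X_1 / theta_1 given D = t; it is only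
   meaningful when 0 < pdf_D f lambda t < +oo. *)
Definition cond_pdf (R : realType) (f : R * R -> R) (lambda t s : R) : R :=
  (s / lambda * f (s, s * t / lambda) / fine (pdf_D f lambda t))%R.

(* m is a median of the conditional distribution of Z_1 given D = t. *)
Definition is_cond_median (R : realType) (f : R * R -> R) (lambda t m : R) :
    Prop :=
  [/\ 0 < pdf_D f lambda t, pdf_D f lambda t < +oo &
      \int[@lebesgue_measure R]_(s in `]0%R, m]) (cond_pdf f lambda t s)%:E
      = (2^-1)%:E].

(* W is only used on (0, oo); its other values are junk. *)
Definition general_loss (R : realType) (W : R -> R) : Prop :=
  [/\ (forall t : R, (0 < t)%R -> (0 <= W t)%R),
      W 1%R = 0%R,
      (forall s t : R, (0 < s)%R -> (s < t)%R -> (t < 1)%R -> (W t < W s)%R) &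
      (forall s t : R, (1 < s)%R -> (s < t)%R -> (W s < W t)%R)].

Definition loss1 (R : realType) (W : R -> R) (theta : R * R) (a : R) : R :=
  W (a / theta.1)%R.

Definition GPN (R : realType) (d : measure_display)
    (Omega : measurableType d) (P : R * R -> probability Omega R)
    (X : Omega -> R * R) (W : R -> R) (delta1 delta2 : R * R -> R)
    (theta : R * R) : \bar R :=
  P theta [set w | (loss1 W theta (delta1 (X w))
                    < loss1 W theta (delta2 (X w)))%R]
  + (2^-1)%:E * P theta [set w | loss1 W theta (delta1 (X w))
                                 = loss1 W theta (delta2 (X w))].

Definition nearer (R : realType) (d : measure_display)
    (Omega : measurableType d) (P : R * R -> probability Omega R)
    (X : Omega -> R * R) (W : R -> R) (delta1 delta2 : R * R -> R) : Prop :=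
  (forall theta, Theta0 theta -> (2^-1)%:E <= GPN P X W delta1 delta2 theta) /\
  (exists2 theta, Theta0 theta & (2^-1)%:E < GPN P X W delta1 delta2 theta).

Definition Dratio (R : realType) (x : R * R) : R := (x.2 / x.1)%R.

Definition scale_est (R : realType) (psi : R -> R) (x : R * R) : R :=
  (psi (Dratio x) * x.1)%R.

(* Values outside (0, oo) are unconstrained. *)
Definition pos_borel (R : realType) (psi : R -> R) : Prop :=
  measurable_fun (`]0%R, +oo[ : set R) psi /\ forall t : R, (0 < t)%R -> (0 < psi t)%R.

(* Main.v *)
(* Write t for the value of D = X_2 / X_1, p = psi t, q = psi10 t, and
   Z = X_1 / theta_1.  If p < q <= 1 / u, then W (q Z) < W (p Z) holds for
   Z <= 1 / q and, W being continuous at 1, even for Z slightly larger.  Since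
   1 / q >= u is at least every conditional median of Z given D = t, that event
   has conditional probability strictly greater than 1 / 2; the case p > q is
   symmetric.  Integrating over D, on the event {psi10 D <> psi D}, which has
   positive probability, the new estimator is strictly closer with probability
   greater than half that of the event; off it the two losses tie. *)
Require Import Defs.
From HB Require Import structures.
From mathcomp Require Import all_boot all_order all_algebra.
From mathcomp Require Import all_classical all_reals all_analysis.
From mathcomp Require Import measurable_realfun interval_inference ring lra.
Import Order.TTheory GRing.Theory Num.Theory.
Import numFieldNormedType.Exports.

Local Open Scope classical_set_scope.
Local Open Scope ring_scope.

Set Implicit Arguments.
Unset Strict Implicit.
Unset Printing Implicit Defensive.

(** * Measurability from monotonicity *)

Lemma nondecreasing_in_measurable (R : realType) (D : set R) (f : R -> R) :
  is_interval D -> {in D &, {homo f : x y / x <= y}} -> measurable_fun D f.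
Proof.
move=> iD f_nd.
apply: (measurability (@RGenCInfty.G R)) => [|/= _ [_] [r] -> <-].
  exact: RGenCInfty.measurableE.
apply: is_interval_measurable => s t/=.
rewrite !in_itv/= !andbT => -[Ds fs] [Dt ft] v /andP[sv vt].
have Dv : D v by apply: (iD s t) => //; rewrite sv vt.
by split => //; rewrite in_itv/= andbT (le_trans fs)// f_nd// inE.
Qed.

Lemma nonincreasing_in_measurable (R : realType) (D : set R) (f : R -> R) :
  is_interval D -> {in D &, {homo f : x y /~ x <= y}} -> measurable_fun D f.
Proof.
move=> iD f_ni; rewrite -(opprK f); apply/measurable_funN.
by apply: nondecreasing_in_measurable => // s t Ds Dt st; rewrite lerN2 f_ni.
Qed.

Lemma measurable_inv_pos (R : realType) :
  measurable_fun (`]0, +oo[ : set R) (fun x : R => x^-1).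
Proof.
apply: nonincreasing_in_measurable; first exact: interval_is_interval.
move=> x y; rewrite !inE/= !in_itv/= !andbT => x0 y0 xy.
by rewrite lef_pV2.
Qed.

(** Measurability comes from the shape of [W], monotone on each side of 1. The endpoint 1 joins the
    right piece because [W 1 = 0] is the least value there. *)
Lemma measurable_general_loss (R : realType) (W : R -> R) :
  general_loss W -> measurable_fun (`]0, +oo[ : set R) W.
Proof.
move=> [W0 W1 Wdec Winc].
have -> : `]0, +oo[%classic = `]0, 1[%classic `|` `[1, +oo[%classic :> set R.
  apply/seteqP; split => x /=; rewrite !in_itv/= ?andbT; last by lra.
  by move=> x0; have [?|?] := ltP x 1; [left|right]; rewrite ?x0.
apply/measurable_funU => //; split.
  apply: nonincreasing_in_measurable; first exact: interval_is_interval.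
  move=> x y; rewrite !inE/= !in_itv/= => /andP[x0 x1] /andP[y0 y1].
  by rewrite le_eqVlt => /predU1P[->//|yx]; rewrite ltW// Wdec.
apply: nondecreasing_in_measurable; first exact: interval_is_interval.
move=> x y; rewrite !inE/= !in_itv/= !andbT => x1 y1.
rewrite le_eqVlt => /predU1P[->//|xy].
move: x1; rewrite le_eqVlt => /predU1P[<-|x1]; last by rewrite ltW// Winc.
by rewrite W1 W0//; lra.
Qed.

(** * Comparison of the two losses near [1 / q] *)

Section general_loss.
Context (R : realType) (W : R -> R).
Hypothesis hW : general_loss W.

(** Strict monotonicity compares only points on the same open side of 1, so [W t] is compared with
    the nonnegative value at the midpoint of [t] and 1. *)
Lemma general_loss_gt0 (t : R) : 0 < t -> t != 1 -> 0 < W t.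
Proof.
case: hW => W0 W1 Wdec Winc t0; rewrite neq_lt => /orP[t1|t1].
  apply: le_lt_trans (Wdec t ((t + 1) / 2) _ _ _); [apply: W0| | |]; lra.
apply: le_lt_trans (Winc ((t + 1) / 2) t _ _); [apply: W0| |]; lra.
Qed.

Hypothesis hWc : {for 1, continuous W}.

(* The continuity of [W] at [1] lets the comparison overshoot [1 / q]. *)
Lemma general_loss_lt_low (p q : R) : 0 < p -> p < q ->
  exists2 c, q^-1 < c & forall z, 0 < z -> z <= c -> W (q * z) < W (p * z).
Proof.
case: (hW) => W0 W1 Wdec Winc p0 pq.
have q0 : 0 < q by lra.
pose s := p / q.
have s0 : 0 < s by rewrite divr_gt0.
have s1 : s < 1 by rewrite ltr_pdivrMr// mul1r.
(* [W r] separates the losses when [q * z] slightly exceeds 1: by continuity [W (q * z)] lies below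
   it, while [p * z = s * (q * z)] stays at most [r < 1]. *)
pose r := (s + 1) / 2.
have Wr : 0 < W r by apply: general_loss_gt0; [|apply/eqP]; rewrite /r; lra.
have : \forall x \near (1 : R), W x < W r.
  by apply: cvgr_lt hWc _ _; rewrite W1.
move=> /nbhs_ballP[e /= e0 eW].
(* The first bound keeps [q * z] in the continuity ball; the second gives [s * (1 + eta) <= r]. *)
pose eta := Num.min (e / 2) ((1 - s) / 2).
have eta0 : 0 < eta by rewrite lt_min; apply/andP; split; lra.
have etae : eta <= e / 2 by rewrite ge_min lexx.
have etas : eta <= (1 - s) / 2 by rewrite ge_min lexx orbT.
exists ((1 + eta) / q).
  by rewrite -[X in X < _]mul1r ltr_pM2r ?invr_gt0//; lra.
move=> z z0 zc.
have qz0 : 0 < q * z by rewrite mulr_gt0.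
have qz : q * z <= 1 + eta by rewrite mulrC -ler_pdivlMr.
have pz0 : 0 < p * z by rewrite mulr_gt0.
have pzE : p * z = s * (q * z) by rewrite /s mulrA divfK// gt_eqF.
have pzqz : p * z < q * z by rewrite ltr_pM2r.
have [qz1|qz1|qz1] := ltgtP (q * z) 1.
- exact: Wdec.
- apply: (@lt_le_trans _ _ (W r)).
    by apply: eW; rewrite /ball/= distrC ger0_norm; lra.
  have : p * z <= r.
    rewrite pzE (@le_trans _ _ (s * (1 + eta)))// ?ler_wpM2l//; first lra.
    by rewrite /r; nra.
  rewrite le_eqVlt => /predU1P[->//|pzr].
  by rewrite ltW// Wdec// /r; lra.
- by rewrite qz1 W1 general_loss_gt0// lt_eqF// -qz1.
Qed.

(** Mirror image of the previous bound: [q * z] may now fall slightly below 1, and [W (p * z)] is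
    bounded below by [W r] for some [r > 1]. *)
Lemma general_loss_lt_high (p q : R) : 0 < q -> q < p ->
  exists c, [/\ 0 < c, c < q^-1 & forall z, c < z -> W (q * z) < W (p * z)].
Proof.
case: (hW) => W0 W1 Wdec Winc q0 qp.
have p0 : 0 < p by lra.
pose s := p / q.
have s1 : 1 < s by rewrite ltr_pdivlMr// mul1r.
pose r := (s + 1) / 2.
have Wr : 0 < W r by apply: general_loss_gt0; [|apply/eqP]; rewrite /r; lra.
have : \forall x \near (1 : R), W x < W r.
  by apply: cvgr_lt hWc _ _; rewrite W1.
move=> /nbhs_ballP[e /= e0 eW].
(* The bound [1 / 2] keeps [c] positive; the last one is equivalent to [s * (1 - eta) >= r]. *)
pose eta := Num.min (Num.min (e / 2) (1 / 2)) ((s - 1) / (2 * s)).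
have eta0 : 0 < eta.
  by rewrite !lt_min -andbA; apply/and3P; split; rewrite ?divr_gt0//; lra.
have etae : eta <= e / 2 by rewrite !ge_min lexx.
have eta1 : eta <= 1 / 2 by rewrite !ge_min lexx orbT.
have etas : eta <= (s - 1) / (2 * s) by rewrite !ge_min lexx !orbT.
have {}etas : s * (1 - eta) >= r.
  move: etas; rewrite ler_pdivlMr; last lra.
  by rewrite /r; lra.
exists ((1 - eta) / q); split.
- by rewrite divr_gt0//; lra.
- by rewrite -[X in _ < X]mul1r ltr_pM2r ?invr_gt0//; lra.
move=> z zc.
have qz : 1 - eta < q * z by rewrite [q * z]mulrC -ltr_pdivrMr.
have qz0 : 0 < q * z by lra.
have z0 : 0 < z by rewrite -(pmulr_rgt0 _ q0).
have pz0 : 0 < p * z by rewrite mulr_gt0.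
have pzE : p * z = s * (q * z) by rewrite /s mulrA divfK// gt_eqF.
have pzqz : q * z < p * z by rewrite ltr_pM2r.
have [qz1|qz1|qz1] := ltgtP (q * z) 1.
- apply: (@lt_le_trans _ _ (W r)).
    by apply: eW; rewrite /ball/= ger0_norm; lra.
  have : r <= p * z.
    by rewrite pzE (le_trans etas)// ler_wpM2l//; lra.
  rewrite le_eqVlt => /predU1P[->//|pzr].
  by rewrite ltW// Winc// /r; lra.
- exact: Winc.
- by rewrite qz1 W1 general_loss_gt0// gt_eqF// -qz1.
Qed.

End general_loss.

(** * Changes of variables for Lebesgue integrals *)

Section lebesgue_change.
Context (R : realType).
Local Notation mu := (@lebesgue_measure R).
Local Open Scope ereal_scope.

(** Lebesgue measure equals [c] times its image under multiplication by [c]: the two agree on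
    half-open intervals, and uniqueness of Lebesgue measure does the rest. *)
Lemma ge0_integral_lebesgue_scale (c : R) (F : R -> \bar R) : (0 < c)%R ->
  measurable_fun [set: R] F -> (forall x, 0 <= F x) ->
  \int[mu]_x F x = c%:E * \int[mu]_x F (c * x)%R.
Proof.
move=> c0 mF F0.
pose phi : measurableTypeR R -> measurableTypeR R := fun x => (c * x)%R.
have mphi : measurable_fun [set: measurableTypeR R] phi.
  exact: measurable_funM.
pose cnn : {nonneg R} := NngNum (ltW c0).
have E A : measurable A ->
    mu A = mscale cnn (pushforward mu phi) A.
  move=> mA; apply: lebesgue_measure_unique => //= _ [[a b]] _ <-.
  rewrite /mscale /= /pushforward/=.
  have -> : phi @^-1` `]a, b]%classic = `](a / c)%R, (b / c)%R]%classic.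
    by apply/seteqP; split => x /=;
      rewrite !in_itv/= /phi ltr_pdivrMr// ler_pdivlMr// mulrC.
  rewrite !lebesgue_measure_itv/= !lte_fin ltr_pM2r ?invr_gt0//.
  case: ifPn => _; last by rewrite mule0.
  by rewrite -EFinD -EFinM -mulrBl mulrCA divff ?mulr1// gt_eqF.
have -> : \int[mu]_x F (c * x)%R =
    \int[pushforward mu phi]_(x in [set: measurableTypeR R]) F x.
  by rewrite (ge0_integral_pushforward mphi).
rewrite -[c%:E]/(cnn%:num%:E) -ge0_integral_mscale//.
by apply: eq_measure_integral => //= A mA AS; exact: E.
Qed.

(* Substitution [x_1 = c z], [x_2 = c z t], of Jacobian [c^2 z]. *)
Lemma integral_ratio (c : R) (g : R * R -> R) : (0 < c)%R ->
  measurable_fun [set: R * R] g -> (forall x, (0 <= g x)%R) ->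
  (forall x, (x.1 <= 0)%R -> g x = 0%R) ->
  \int[mu \x mu]_x (g x)%:E =
  \int[mu]_t \int[mu]_z (c ^+ 2 * z * g (c * z, c * z * t)%R)%:E.
Proof.
move=> c0 mg g0 gneg.
(* [G] is the integrand after the inner substitution [y = x * t], Jacobian included. Tonelli then
   exchanges the variables, and the remaining one is scaled by [c]. *)
pose G (x : R * R) := (x.1 * g (x.1, x.1 * x.2))%R.
have mG : measurable_fun [set: R * R] G.
  apply: measurable_funM => //.
  apply: measurableT_comp => //; apply: measurable_fun_pair => //.
  exact: measurable_funM.
have G0 x : (0 <= G x)%R.
  have [x0|x0] := leP x.1 0%R; first by rewrite /G (gneg (_, _))//= mulr0.
  by rewrite mulr_ge0// ltW.
have mEg : measurable_fun [set: R * R] (EFin \o g) by exact/measurable_EFinP.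
have mEG : measurable_fun [set: R * R] (EFin \o G) by exact/measurable_EFinP.
rewrite fubini_tonelli1//.
transitivity (\int[mu]_x \int[mu]_t (G (x, t))%:E).
  apply: eq_integral => x _; rewrite /fubini_F.
  have [x0|x0] := leP x 0%R.
    rewrite !integral0_eq// => t _; rewrite /G /= gneg//.
    by rewrite mulr0.
  have -> : \int[mu]_y (g (x, y))%:E = x%:E * \int[mu]_t (g (x, x * t)%R)%:E.
    apply: (ge0_integral_lebesgue_scale (F := fun y => (g (x, y))%:E) x0).
      by apply/measurable_EFinP; exact: measurable_fun_pair2.
    by move=> t; rewrite lee_fin.
  have mgx : measurable_fun [set: R] (fun t : R => (g (x, x * t)%R)%:E).
    apply/measurable_EFinP; apply: measurableT_comp => //.
    by apply: measurable_fun_pair => //; exact: measurable_funM.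
  rewrite -ge0_integralZl//=; last 2 first.
  - by move=> t _; rewrite lee_fin.
  - by rewrite lee_fin ltW.
rewrite (@fubini_tonelli _ _ _ _ _ mu mu (EFin \o G))//=.
apply: eq_integral => t _.
have -> : \int[mu]_z (G (z, t))%:E = c%:E * \int[mu]_z (G (c * z, t)%R)%:E.
  apply: (ge0_integral_lebesgue_scale (F := fun z => (G (z, t))%:E) c0).
    by apply/measurable_EFinP; exact: measurable_fun_pair1.
  by move=> z; rewrite lee_fin.
have mGt : measurable_fun [set: R] (fun z : R => (G (c * z, t)%R)%:E).
  apply/measurable_EFinP.
  apply: (@measurableT_comp _ _ _ _ _ _ (fun x => G (x, t))); last first.
    exact: measurable_funM.
  exact: measurable_fun_pair1.
rewrite -ge0_integralZl//=; last 2 first.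
- by move=> z _; rewrite lee_fin.
- by rewrite lee_fin ltW.
by apply: eq_integral => z _; rewrite /G /= -EFinM; congr EFin; ring.
Qed.

End lebesgue_change.

(** * Medians of a distribution with a density on the positive half-line *)

Section continuous_cdf.
Context (R : realType) (h : R -> R).
Local Notation mu := (@lebesgue_measure R).
Local Open Scope ereal_scope.
Hypothesis mh : measurable_fun [set: R] h.
Hypothesis h0 : forall s : R, (0 <= s)%R -> (0 <= h s)%R.
Hypothesis h1 : \int[mu]_(s in `]0%R, +oo[) (h s)%:E = 1.

Let J (c : R) := \int[mu]_(s in `]0%R, c]) (h s)%:E.

Let mhD (D : set R) : measurable_fun D (EFin \o h).
Proof. by apply/measurable_EFinP; exact: measurable_funTS. Qed.

Let J_le (a b : R) : (a <= b)%R -> J a <= J b.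
Proof.
move=> ab; apply: ge0_subset_integral => //.
- exact: mhD.
- by move=> s /=; rewrite in_itv/= lee_fin => /andP[/ltW s0 _]; exact: h0.
- by apply: subset_itvl; rewrite bnd_simp.
Qed.

Let J_le1 (b : R) : J b <= 1.
Proof.
rewrite -h1; apply: ge0_subset_integral => //.
- exact: mhD.
- by move=> s /=; rewrite in_itv/= lee_fin => /andP[/ltW s0 _]; exact: h0.
- by apply: subset_itvl; rewrite bnd_simp.
Qed.

(** The indefinite integral of an integrable function is continuous, so the intermediate value
    theorem applies to [J]. *)
Let cdf_ivt (a b v : R) : (0 <= a)%R -> (a <= b)%R ->
  J a <= v%:E -> v%:E <= J b -> exists2 m : R, (a <= m <= b)%R & J m = v%:E.
Proof.
move=> a0 ab Jav vJb.
have JE x : J x = \int[mu]_(s in `[0%R, x]) (h s)%:E.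
  by rewrite /J integral_itv_obnd_cbnd.
have inth : mu.-integrable `[0%R, b] (EFin \o h).
  apply/integrableP; split; first exact: mhD.
  have -> : \int[mu]_(s in `[0%R, b]) `|(EFin \o h) s| = J b.
    rewrite JE; apply: eq_integral => s; rewrite inE/= in_itv/= => /andP[s0 _].
    by rewrite ger0_norm// h0.
  by rewrite (le_lt_trans (J_le1 b)) ?ltry.
pose F (x : R) := parameterized_integral mu 0%R x h.
have FE x : J x = (F x)%:E.
  rewrite JE /F /parameterized_integral /Rintegral fineK// -JE.
  rewrite ge0_fin_numE; last first.
    apply: integral_ge0 => s /=; rewrite in_itv/= lee_fin => /andP[/ltW s0 _].
    exact: h0.
  by rewrite (le_lt_trans (J_le1 x)) ?ltry.
have cF : {within `[a, b], continuous F}.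
  apply: (@continuous_subspaceW _ _ _ `[0%R, b]).
    by apply: subset_itvr; rewrite bnd_simp.
  by apply: parameterized_integral_continuous => //; exact: le_trans ab.
move: Jav vJb; rewrite !FE !lee_fin => Fav vFb.
have [|m mab Fm] := IVT ab cF (v := v).
  by rewrite ge_min le_max Fav vFb orbT.
by exists m; [move: mab; rewrite in_itv|rewrite FE Fm].
Qed.

(** The intervals []0, n]] exhaust the half-line, so [J n] tends to the total mass 1. *)
Let cdf_near1 (v : R) : (v < 1)%R -> exists n : nat, v%:E < J n%:R.
Proof.
move=> v1.
have E : `]0%R, +oo[%classic = \bigcup_n `]0%R, n%:R]%classic :> set R.
  apply/seteqP; split => x /=; rewrite in_itv/= ?andbT.
    move=> x0; exists (Num.truncn x).+1 => //=; rewrite in_itv/= x0/=.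
    by rewrite ltW// truncnS_gt.
  by move=> [n _] /=; rewrite in_itv/= => /andP[].
have : J n%:R @[n --> \oo] --> (1 : \bar R).
  rewrite -h1 E; apply: ge0_nondecreasing_set_cvg_integral => //.
  - move=> m n mn; rewrite subsetEset; apply: subset_itvl.
    by rewrite bnd_simp ler_nat.
  - by move=> n; exact: mhD.
  - by move=> n x /=; rewrite in_itv/= lee_fin => /andP[/ltW x0 _]; exact: h0.
move=> Jcvg; apply: contrapT => /forallNP nJ.
suff : (1 : \bar R) <= v%:E by rewrite leNgt lte_fin v1.
rewrite -(cvg_lim _ Jcvg)//; apply: lime_le; first by apply/cvg_ex; exists 1.
by apply: nearW => n; rewrite leNgt; apply/negP.
Qed.

(** If [J c] were at most one half, [J] would still have to reach one half at or beyond [c], giving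
    a median that is not below [c]. Medians need not be unique, hence the quantification over all of
    them. *)
Lemma half_lt_cdf (c : R) : (0 <= c)%R ->
  (forall m, J m = (2^-1)%:E -> (m < c)%R) -> (2^-1)%:E < J c.
Proof.
move=> c0 medc; rewrite ltNge; apply/negP => Jc.
have [n Jn] := @cdf_near1 2^-1%R ltac:(lra).
have [|||m /andP[cm _] /medc] := @cdf_ivt c (Num.max c n%:R) 2^-1 c0.
- by rewrite le_max lexx.
- exact: Jc.
- by rewrite (le_trans (ltW Jn))// J_le// le_max lexx orbT.
- by rewrite ltNge cm.
Qed.

(** If [J c] were at least one half, a median would exist in [[0, c]]. So [J c] is below one half,
    and the complementary tail exceeds it. *)
Lemma half_lt_tail (c : R) : (0 <= c)%R ->
  (forall m, J m = (2^-1)%:E -> (c < m)%R) ->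
  (2^-1)%:E < \int[mu]_(s in `]c, +oo[) (h s)%:E.
Proof.
move=> c0 medc.
have Jc : J c < (2^-1)%:E.
  rewrite ltNge; apply/negP => Jc.
  have [||m /andP[_ mc] /medc] := @cdf_ivt 0%R c 2^-1%R (lexx _) c0.
  - by rewrite /J set_itvoc0 integral_set0 lee_fin; lra.
  - exact: Jc.
  - by rewrite ltNge mc.
have : J c + \int[mu]_(s in `]c, +oo[) (h s)%:E = 1.
  rewrite -h1 -ge0_integral_setU//.
  - congr (integral _ _ _); apply/seteqP.
    split => x /=; rewrite !in_itv/= ?andbT.
      by move=> [/andP[]//|cx]; lra.
    by move=> x0; have [xc|cx] := leP x c; [left; rewrite x0|right].
  - exact: mhD.
  - by move=> x [|] /=; rewrite in_itv/= lee_fin => /andP[x0 _]; apply: h0; lra.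
  - apply/disj_setPS => x [/=]; rewrite !in_itv/= => /andP[_ ?] /andP[? _]; lra.
move=> JT; rewrite ltNge; apply/negP => T.
have : J c + \int[mu]_(s in `]c, +oo[) (h s)%:E < (2^-1)%:E + (2^-1)%:E.
  by apply: (le_lt_trans (leeD2l _ T)); rewrite lteD2rE.
by rewrite JT -EFinD lte_fin; lra.
Qed.

End continuous_cdf.

(** * Integration of a strict pointwise inequality *)

Section half_integral.
Local Open Scope ereal_scope.

(** The set [S] where [G] is positive and finite carries the whole integral of [G]. On it
    [F - G / 2] is strictly positive; were its integral zero, [S] would be negligible and [G] would
    integrate to 0. *)
Lemma half_integral_lt d (T : measurableType d) (R : realType)
    (m : {measure set T -> \bar R}) (F G : T -> \bar R) :
  measurable_fun setT F -> measurable_fun setT G ->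
  (forall t, 0 <= F t) -> (forall t, 0 <= G t) ->
  0 < \int[m]_t G t -> \int[m]_t G t < +oo ->
  (forall t, 0 < G t -> G t < +oo -> (2^-1)%:E * G t < F t) ->
  (2^-1)%:E * \int[m]_t G t < \int[m]_t F t.
Proof.
move=> mF mG F0 G0 iG0 iGoo GF.
pose S := [set t | (0 < G t)%E /\ (G t < +oo)%E].
have mS : measurable S.
  rewrite (_ : S = setT `&` [set t | 0 < G t] `&`
      (setT `&` [set t | G t < +oo])).
    apply: measurableI; first exact: emeasurable_fun_o_infty.
    exact: emeasurable_fun_infty_o.
  by rewrite !setTI.
have iG : m.-integrable setT G.
  by apply/integrableP; split => //; under eq_integral do rewrite gee0_abs//.
(* Off [S], [G] is either 0 or infinite, and integrability makes the latter negligible. *)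
have GS : \int[m]_t G t = \int[m]_(t in S) G t.
  rewrite [RHS]integral_mkcond; apply: ge0_ae_eq_integral => //.
  - by apply/(measurable_restrictT G mS); exact: measurable_funTS.
  - by move=> t _; exact: erestrict_ge0.
  - have := integrable_ae measurableT iG.
    apply: filterS => t Gfin _; rewrite patchE; case: ifPn => // /negP.
    rewrite inE => nS; apply/eqP; rewrite eq_le G0 andbT leNgt.
    apply/negP => Gt0.
    by apply: nS; split => //; rewrite -ge0_fin_numE// Gfin.
pose H t := (F t - (2^-1)%:E * G t)%E.
have gfin t : S t -> ((2^-1)%:E * G t)%E \is a fin_num.
  by move=> [Gt0 Gtoo]; rewrite fin_numM// ge0_fin_numE// ltW.
have mg : measurable_fun S (fun t => (2^-1)%:E * G t)%E.
  by apply: measurable_funeM; exact: measurable_funTS.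
have mH : measurable_fun S H.
  by apply: emeasurable_funB => //; exact: measurable_funTS.
have H0 t : S t -> (0 < H t)%E.
  by move=> St; rewrite sube_gt0; case: St; exact: GF.
have FE : (\int[m]_(t in S) F t =
    (2^-1)%:E * \int[m]_t G t + \int[m]_(t in S) H t)%E.
  rewrite GS -ge0_integralZl//=; last exact: measurable_funTS.
  rewrite -ge0_integralD//=; last 2 first.
  - by move=> t _; rewrite mule_ge0// lee_fin.
  - by move=> t /H0/ltW.
  apply: eq_integral => t /[!inE] St.
  by rewrite /H addeC subeK// gfin.
apply: (@lt_le_trans _ _ (\int[m]_(t in S) F t)%E); last first.
  exact: ge0_subset_integral.
rewrite FE lteDl; last first.
  by rewrite fin_numM// ge0_fin_numE// ltW.
rewrite lt0e integral_ge0 ?andbT; last by move=> t /H0/ltW.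
apply/eqP => iH0.
have : ae_eq m S H (cst 0).
  apply/ae_eq_integral_abs => //; rewrite -iH0.
  apply: eq_integral => t /[!inE] St.
   by rewrite gee0_abs// ltW// H0.
move=> HS.
have : \int[m]_(t in S) G t = 0.
  have -> : 0 = \int[m]_(t in S) (cst 0 t) by rewrite integral0.
  apply: ge0_ae_eq_integral => //; first by apply: measurable_funTS.
  apply: filterS HS => t HS St.
  by have := H0 _ St; rewrite HS// ltxx.
by rewrite -GS => iG00; rewrite iG00 ltxx in iG0.
Qed.

End half_integral.

(** * The conditional distribution of [Z_1] at a fixed value of [D] *)

Section slice.
Context (R : realType) (f : R * R -> R) (lambda t : R).
Local Notation mu := (@lebesgue_measure R).
Hypothesis mf : measurable_fun [set: R * R] f.
Hypothesis f0 : forall x, 0 <= f x.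
Hypothesis lambda0 : 0 < lambda.
Hypothesis pdf0 : (0 < pdf_D f lambda t)%E.
Hypothesis pdfoo : (pdf_D f lambda t < +oo)%E.

Lemma measurable_pdf_slice :
  measurable_fun [set: R] (fun s : R => s / lambda * f (s, s * t / lambda)).
Proof.
apply: measurable_funM; first exact: measurable_funM.
apply: measurableT_comp => //; apply: measurable_fun_pair => //.
by apply: measurable_funM => //; exact: measurable_funM.
Qed.

Lemma pdf_slice_ge0 (s : R) : 0 <= s -> 0 <= s / lambda * f (s, s * t / lambda).
Proof. by move=> s0; rewrite mulr_ge0// divr_ge0// ltW. Qed.

Lemma measurable_cond_pdf : measurable_fun [set: R] (cond_pdf f lambda t).
Proof. by apply: measurable_funM => //; exact: measurable_pdf_slice. Qed.

Lemma pdf_slice_cond (I : set R) : measurable I -> I `<=` `]0, +oo[%classic ->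
  (\int[mu]_(s in I) (s / lambda * f (s, s * t / lambda))%:E =
   pdf_D f lambda t * \int[mu]_(s in I) (cond_pdf f lambda t s)%:E)%E.
Proof.
move=> mI I0.
have pdf_fin : pdf_D f lambda t \is a fin_num by rewrite ge0_fin_numE// ltW.
have g0 : (0 < fine (pdf_D f lambda t))%R by rewrite fine_gt0// pdf0 pdfoo.
rewrite -{1}(fineK pdf_fin) -ge0_integralZl//=; last 3 first.
- apply/measurable_EFinP; apply: measurable_funTS.
  exact: measurable_cond_pdf.
- move=> s /I0 /=; rewrite in_itv/= andbT => s0.
  by rewrite lee_fin divr_ge0 ?pdf_slice_ge0// ltW.
- by rewrite lee_fin ltW.
apply: eq_integral => s _.
by rewrite -EFinM /cond_pdf [in RHS]mulrCA divff ?mulr1// gt_eqF.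
Qed.

Lemma integral_cond_pdf :
  (\int[mu]_(s in `]0%R, +oo[) (cond_pdf f lambda t s)%:E = 1)%E.
Proof.
have pdf_fin : pdf_D f lambda t \is a fin_num by rewrite ge0_fin_numE// ltW.
(* On the whole half-line the factorisation reads [pdf_D = pdf_D * mass]. Since [pdf_D] is positive
   and finite, it cancels and excludes an infinite mass. *)
have := @pdf_slice_cond `]0, +oo[%classic (measurable_itv _) (@subset_refl _ _).
rewrite -[X in X = _ -> _]/(pdf_D f lambda t) -{1 2}(fineK pdf_fin).
have g0 : 0 < fine (pdf_D f lambda t) by rewrite fine_gt0// pdf0 pdfoo.
case: (\int[mu]_(s in _) _)%E => [r| |].
- rewrite -EFinM => -[] gr; congr EFin.
  by apply: (@mulfI _ (fine (pdf_D f lambda t))); rewrite ?gt_eqF// mulr1.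
- by rewrite mulry gtr0_sg// mul1e.
- by rewrite mulrNy gtr0_sg// mul1e.
Qed.

(** The favourable values of [Z_1] are delivered as an explicit set [I], so that its slice mass can
    later be compared with that of the event where the new loss is smaller. *)
Lemma cond_prob_closer_gt_half (W : R -> R) (l u p q : R) :
  general_loss W -> {for 1, continuous W} -> 0 < t -> 0 < l -> 0 < p -> 0 < q ->
  (forall m, is_cond_median f lambda t m -> l <= m /\ m <= u) ->
  (p < u^-1 -> p < q /\ q <= u^-1) ->
  (l^-1 < p -> l^-1 <= q /\ q < p) ->
  (u^-1 <= p -> p <= l^-1 -> q = p) ->
  q != p ->
  exists I : set R, [/\ measurable I, I `<=` `]0, +oo[%classic,
    forall z, I z -> W (q * z) < W (p * z) &
    ((2^-1)%:E < \int[mu]_(s in I) (cond_pdf f lambda t s)%:E)%E].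
Proof.
move=> hW hWc t0 l0 p0 q0 med low high mid qp.
have cond0 s : 0 <= s -> 0 <= cond_pdf f lambda t s.
  move=> s0; rewrite /cond_pdf divr_ge0 ?pdf_slice_ge0//.
  by rewrite fine_ge0// ltW.
have [pu|up] := ltP p u^-1.
  have [pq qu] := low pu.
  have [c qc Wc] := general_loss_lt_low hW hWc p0 pq.
  (* The sign of [u] is read off [0 < p < u^-1]. Then [m <= u <= q^-1 < c] puts every median
     strictly below [c]. *)
  have u0 : 0 < u by rewrite -invr_gt0; lra.
  have q'0 : 0 < q^-1 by rewrite invr_gt0.
  have uq : u <= q^-1 by rewrite -[u]invrK lef_pV2// posrE invr_gt0.
  exists `]0, c]%classic; split => //.
  - by apply: subset_itvl.
  - by move=> z /=; rewrite in_itv/= => /andP[z0 zc]; exact: Wc.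
  - apply: (half_lt_cdf measurable_cond_pdf cond0 integral_cond_pdf); first lra.
    move=> m Jm; have [|_ um] := med m; first by split.
    lra.
have [pl|lp] := leP p l^-1; first by rewrite mid// eqxx in qp.
have [lq {}qp] := high lp.
have [c [c0 cq Wc]] := general_loss_lt_high hW hWc q0 qp.
have ql : q^-1 <= l by rewrite -[l]invrK lef_pV2// posrE invr_gt0.
exists `]c, +oo[%classic; split => //.
- by apply: subset_itvr; rewrite bnd_simp ltW.
- by move=> z /=; rewrite in_itv/= andbT; exact: Wc.
- apply: (half_lt_tail measurable_cond_pdf cond0 integral_cond_pdf); first lra.
  move=> m Jm; have [|lm _] := med m; first by split.
  lra.
Qed.

End slice.

(** * The joint law of [D] and [Z_1] *)

Section ratio_law.
Context (R : realType).
Local Notation mu := (@lebesgue_measure R).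

Let Q : set (R * R) := [set x | 0 < x.1 /\ 0 < x.2].

Let mQ : measurable Q.
Proof.
rewrite (_ : Q = `]0, +oo[%classic `*` `]0, +oo[%classic).
  exact: measurableX.
by apply/seteqP; split => -[x y] /=; rewrite !in_itv/= !andbT.
Qed.

(* Joint density of [(D, Z_1)], restricted to the event [X \in A]; the first
   coordinate is the value of [D] and [c] stands for [theta_1]. *)
Definition ratio_density (f : R * R -> R) (lambda c : R) (A : set (R * R))
    (x : R * R) : R :=
  x.2 / lambda * f (x.2, x.2 * x.1 / lambda) *
  \1_(Q `&` [set y | A (c * y.2, c * y.2 * y.1)]) x.

Lemma measurable_ratio_density (f : R * R -> R) (lambda c : R)
    (A : set (R * R)) :
  measurable_fun [set: R * R] f -> measurable A ->
  measurable_fun [set: R * R] (ratio_density f lambda c A).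
Proof.
move=> mf mA; apply: measurable_funM.
  apply: measurable_funM; first exact: measurable_funM.
  apply: measurableT_comp => //; apply: measurable_fun_pair => //.
  by apply: measurable_funM => //; exact: measurable_funM.
apply: measurable_indic; apply: measurableI => //.
rewrite -[X in measurable X]setTI.
have mphi :
    measurable_fun [set: R * R] (fun y : R * R => (c * y.2, c * y.2 * y.1)).
  apply: measurable_fun_pair; first exact: measurable_funM.
  by apply: measurable_funM => //; exact: measurable_funM.
exact: mphi.
Qed.

Lemma ratio_density_ge0 (f : R * R -> R) (lambda c : R) (A : set (R * R)) x :
  (forall x, 0 <= f x) -> 0 < lambda ->
  0 <= ratio_density f lambda c A x.
Proof.
move=> f0 lambda0; rewrite /ratio_density indicE.
case: (boolP (_ \in _)) => [/set_mem[[_ x20] _]|_]; last by rewrite mulr0.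
by rewrite mulr1 pdf_slice_ge0// ltW.
Qed.

Lemma measurable_ratio_marginal (f : R * R -> R) (lambda c : R)
    (A : set (R * R)) :
  measurable_fun [set: R * R] f -> (forall x, 0 <= f x) -> 0 < lambda ->
  measurable A -> measurable_fun [set: measurableTypeR R]
    (fun t => \int[mu]_z (ratio_density f lambda c A (t, z))%:E)%E.
Proof.
move=> mf f0 lambda0 mA.
have mk : measurable_fun [set: R * R] (EFin \o ratio_density f lambda c A).
  by apply/measurable_EFinP; exact: measurable_ratio_density.
apply: (@measurable_fun_fubini_tonelli_F _ _ _ _ _ mu
  (EFin \o ratio_density f lambda c A)) => //.
by move=> x; rewrite /= lee_fin ratio_density_ge0.
Qed.

(** This is [integral_ratio] with [c = theta.1]. As [X] takes values in the quadrant [Q], [A] may be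
    cut down to [Q], which makes the integrand vanish for [x.1 <= 0], as that substitution
    demands. *)
Lemma scale_model_ratio d (Omega : measurableType d) (f : R * R -> R)
    (P : R * R -> probability Omega R) (X : {mfun Omega >-> (R * R)%type})
    (theta : R * R) (A : set (R * R)) :
  scale_model f P X -> Theta0 theta -> measurable A ->
  P theta (X @^-1` A) = (\int[mu]_t \int[mu]_z
    (ratio_density f (theta.2 / theta.1) theta.1 A (t, z))%:E)%E.
Proof.
move=> [[mf f0 _] Xpos Xlaw] theta0 mA.
have [c0 c12] : 0 < theta.1 /\ theta.1 <= theta.2 by exact: theta0.
have theta20 : 0 < theta.2 by exact: lt_le_trans c12.
have mAQ : measurable (A `&` Q) by exact: measurableI.
have -> : P theta (X @^-1` A) = distribution (P theta) X (A `&` Q).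
  congr (P theta _); apply/seteqP.
  by split => w; [split => //; exact: Xpos|case].
rewrite Xlaw// integral_mkcond.
pose g x := scale_pdf f theta x * \1_(A `&` Q) x.
have -> : ((fun x => (scale_pdf f theta x)%:E) \_ (A `&` Q))%E = EFin \o g.
  apply/funext => x; rewrite patchE /g /= indicE.
  by case: ifPn => _; rewrite ?mulr1 ?mulr0.
have mg : measurable_fun [set: R * R] g.
  apply: measurable_funM; last exact: measurable_indic.
  apply: measurable_funM => //; apply: measurableT_comp => //.
  by apply: measurable_fun_pair; exact: measurable_funM.
rewrite (integral_ratio c0 mg); last 2 first.
- move=> x; rewrite mulr_ge0// mulr_ge0// invr_ge0 mulr_ge0//; exact: ltW.
- move=> x x0; rewrite /g indicE memNset ?mulr0// => -[_ [/=]].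
  by rewrite ltNge x0.
apply: eq_integral => t _; apply: eq_integral => z _; congr EFin.
rewrite /g /ratio_density /scale_pdf/=.
have -> : \1_(A `&` Q) (theta.1 * z, theta.1 * z * t) =
   \1_(Q `&` [set y | A (theta.1 * y.2, theta.1 * y.2 * y.1)]) (t, z) :> R.
  rewrite !indicE; congr ((nat_of_bool _)%:R).
  apply/idP/idP; rewrite !inE/= /Q/=.
    move=> [? [+ +]]; rewrite pmulr_rgt0// => z0.
    by rewrite !pmulr_rgt0// mulr_gt0.
  by move=> [[t0 z0] ?]; rewrite !mulr_gt0.
have -> : theta.1 * z / theta.1 = z by field; rewrite gt_eqF.
have -> : theta.1 * z * t / theta.2 = z * t / (theta.2 / theta.1).
  by field; rewrite !gt_eqF.
(* The Jacobian [theta.1 ^+ 2 * z] times [(theta.1 * theta.2)^-1] leaves [z / lambda]. *)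
rewrite !mulrA; congr (_ * _ * _).
by field; rewrite !gt_eqF.
Qed.

End ratio_law.

(** * From slices to the GPN criterion *)

Theorem corollary4p1p1 (R : realType) (d : measure_display)
    (Omega : measurableType d) (f : R * R -> R)
    (P : R * R -> probability Omega R) (X : {mfun Omega >-> (R * R)%type})
    (W : R -> R) (l u psi psi10 : R -> R)
    (hX : scale_model f P X)
    (hW : general_loss W)
    (hWc : {for 1, continuous W})
    (hl : forall t : R, 0 < t -> 0 < l t)
    (hlu : forall lambda t m : R, 1 <= lambda -> 0 < t ->
       is_cond_median f lambda t m -> l t <= m /\ m <= u t)
    (hpsi : pos_borel psi)
    (hpsi10 : pos_borel psi10)
    (hlow : forall t : R, 0 < t -> psi t < (u t)^-1 ->
       psi t < psi10 t /\ psi10 t <= (u t)^-1)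
    (hhigh : forall t : R, 0 < t -> (l t)^-1 < psi t ->
       (l t)^-1 <= psi10 t /\ psi10 t < psi t)
    (hmid : forall t : R, 0 < t -> (u t)^-1 <= psi t -> psi t <= (l t)^-1 ->
       psi10 t = psi t)
    (hP : forall theta, Theta0 theta ->
       (P theta [set w | ((u (Dratio (X w)))^-1 <= psi (Dratio (X w)))%R /\
                         (psi (Dratio (X w)) <= (l (Dratio (X w)))^-1)%R]
        < 1)%E) :
  nearer P X W (scale_est psi10) (scale_est psi).
Proof.

have [[mf f0 _] Xpos Xlaw] := hX.
have [mpsi psi0] := hpsi; have [mpsi10 psi100] := hpsi10.
(* [psi], [psi10], [W] and the inverse are controlled only on the positive half-line. Their
   restrictions with a default value elsewhere are measurable everywhere and agree with them at all
   values taken through [X]. *)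
pose pos : set R := `]0, +oo[%classic.
have mpos : measurable pos by exact: measurable_itv.
have posE (g : R -> R) t : 0 < t -> (g \_ pos) t = g t.
  by move=> t0; rewrite patchE mem_set// /pos/= in_itv/= t0.
have mres (g : R -> R) : measurable_fun pos g -> measurable_fun setT (g \_ pos).
  by move/(measurable_restrictT g mpos).
pose p := psi \_ pos; pose q := psi10 \_ pos; pose V := W \_ pos.
have mp : measurable_fun setT p by exact: mres.
have mq : measurable_fun setT q by exact: mres.
have mV : measurable_fun setT V by apply: mres; exact: measurable_general_loss.
pose r (x : R * R) := x.2 * ((@GRing.inv R) \_ pos) x.1.
have mr : measurable_fun [set: R * R] r.
  apply: measurable_funM => //; apply: measurableT_comp => //.
  by apply: mres; exact: measurable_inv_pos.
have rE x : 0 < x.1 -> r x = Dratio x by move=> x0; rewrite /r posE.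
suff main theta : Theta0 theta ->
    ((2^-1)%:E < GPN P X W (scale_est psi10) (scale_est psi) theta)%E.
  split => [theta theta0|]; first by rewrite ltW// main.
  by exists (1, 1); [|apply: main]; rewrite /Theta0/= ltr01 lexx.
move=> theta0.
have [c0 c12] : 0 < theta.1 /\ theta.1 <= theta.2 by exact: theta0.
set c := theta.1 in c0 c12 *.
pose lambda := theta.2 / c.
have lambda1 : 1 <= lambda by rewrite ler_pdivlMr// mul1r.
have lambda0 : 0 < lambda by exact: lt_le_trans lambda1.
pose lossq (x : R * R) := V (q (r x) * (x.1 / c)).
pose lossp (x : R * R) := V (p (r x) * (x.1 / c)).
have mlossq : measurable_fun setT lossq.
  apply: measurableT_comp => //; apply: measurable_funM.
    exact: measurableT_comp.
  exact: measurable_funM.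
have mlossp : measurable_fun setT lossp.
  apply: measurableT_comp => //; apply: measurable_funM.
    exact: measurableT_comp.
  exact: measurable_funM.
pose A := [set x | lossq x < lossp x].
pose B := [set x | lossq x = lossp x].
pose E := [set x | q (r x) != p (r x)].
have mA : measurable A.
  by rewrite -[A]setTI; exact: (measurable_fun_ltr mlossq mlossp).
have mB : measurable B.
  rewrite (_ : B = setT `&` (fun x => lossq x == lossp x) @^-1` [set true]).
    exact: (measurable_fun_eqr mlossq mlossp).
  by rewrite setTI; apply/seteqP; split => x /= /eqP.
have mE : measurable E.
  rewrite (_ : E = setT `&` (fun x => q (r x) == p (r x)) @^-1` [set false]).
    exact: (measurable_fun_eqr
      (measurableT_comp mq mr) (measurableT_comp mp mr)).
  rewrite setTI; apply/seteqP.
  by split => x /=; [move/negbTE|rewrite /E/= => ->].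
have mX S : measurable S -> measurable (X @^-1` S).
  by move=> mS; rewrite -[_ @^-1` _]setTI; exact: (measurable_funP X).
have D0 w : 0 < Dratio (X w) by have [? ?] := Xpos w; rewrite divr_gt0.
have qX w : q (r (X w)) = psi10 (Dratio (X w)).
  by have [? ?] := Xpos w; rewrite rE// /q posE.
have pX w : p (r (X w)) = psi (Dratio (X w)).
  by have [? ?] := Xpos w; rewrite rE// /p posE.
have lossqX w : lossq (X w) = loss1 W theta (scale_est psi10 (X w)).
  have [x0 _] := Xpos w.
  rewrite /lossq qX /V posE; first by rewrite /loss1 /scale_est mulrA.
  by rewrite mulr_gt0 ?psi100// divr_gt0.
have losspX w : lossp (X w) = loss1 W theta (scale_est psi (X w)).
  have [x0 _] := Xpos w.
  rewrite /lossp pX /V posE; first by rewrite /loss1 /scale_est mulrA.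
  by rewrite mulr_gt0 ?psi0// divr_gt0.
have GPNE : GPN P X W (scale_est psi10) (scale_est psi) theta =
    (P theta (X @^-1` A) + (2^-1)%:E * P theta (X @^-1` B))%E.
  by rewrite /GPN; congr (P theta _ + _ * P theta _)%E;
    apply/seteqP; split => w; rewrite /A /B /= lossqX losspX.
(* The complement of [E] is exactly the event of [hP]: outside the band between [1 / u] and [1 / l]
   the value of [psi] is strictly moved, inside it is kept. *)
have PEC : (P theta (X @^-1` (~` E)) < 1)%E.
  rewrite (_ : X @^-1` (~` E) = [set w |
      (u (Dratio (X w)))^-1 <= psi (Dratio (X w)) /\
      psi (Dratio (X w)) <= (l (Dratio (X w)))^-1]); first exact: hP.
  apply/seteqP; split => w; rewrite /E /= qX pX.
    move=> /negP/negPn/eqP eqw; rewrite !leNgt; split; apply/negP.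
      by move=> /(hlow _ (D0 w)) []; rewrite eqw ltxx.
    by move=> /(hhigh _ (D0 w)) [_]; rewrite eqw ltxx.
  by move=> [? ?]; rewrite hmid// eqxx.
have PCE : (P theta (X @^-1` (~` E)) = 1 - P theta (X @^-1` E))%E.
  by rewrite preimage_setC (probability_setC _ (mX _ mE)).
have PE0 : (0 < P theta (X @^-1` E))%E.
  rewrite lt0e measure_ge0 andbT; apply/eqP => PE.
  by move: PEC; rewrite PCE PE sube0 ltxx.
have PEoo : (P theta (X @^-1` E) < +oo)%E.
  by rewrite (le_lt_trans (probability_le1 _ (mX _ mE))) ?ltry.
have mAE : measurable (A `&` E) by exact: measurableI.
(* Both probabilities become iterated integrals over [t] and [z], so the claim reduces to a strict
   inequality on each slice where [E] has positive finite density. *)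
have key : ((2^-1)%:E * P theta (X @^-1` E) < P theta (X @^-1` (A `&` E)))%E.
  move: PE0 PEoo.
  rewrite !(scale_model_ratio hX theta0)// -/c -/lambda => PE0 PEoo.
  have kE0 S x : 0 <= ratio_density f lambda c S x by exact: ratio_density_ge0.
  have mk S : measurable S ->
      measurable_fun [set: R * R] (EFin \o ratio_density f lambda c S).
    by move=> mS; apply/measurable_EFinP; exact: measurable_ratio_density.
  apply: half_integral_lt => //.
  - exact: measurable_ratio_marginal.
  - exact: measurable_ratio_marginal.
  - by move=> t; apply: integral_ge0 => z _; rewrite lee_fin.
  - by move=> t; apply: integral_ge0 => z _; rewrite lee_fin.
  move=> t Gt0 Gtoo.
  have t0 : 0 < t.
    rewrite ltNge; apply/negP => t0; move: Gt0.
    rewrite integral0_eq ?ltxx// => z _; congr EFin.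
    rewrite /ratio_density indicE memNset ?mulr0// => -[[/=]].
    by rewrite ltNge t0.
  have rt z : 0 < z -> r (c * z, c * z * t) = t.
    move=> z0; rewrite rE/= ?mulr_gt0// /Dratio/=.
    by field; rewrite !gt_eqF.
  have qpt : psi10 t != psi t.
    apply/negP => /eqP qpt; move: Gt0.
    rewrite integral0_eq ?ltxx// => z _; congr EFin.
    rewrite /ratio_density indicE memNset ?mulr0// => -[[/= _ z0]].
    by rewrite /E/= rt// /q /p !posE// qpt eqxx.
  (* Membership in [E] depends on [t] alone, so the slice of [E] is the full half-line and its mass
     is the density of [D]. *)
  have GtE : (\int[lebesgue_measure]_z (ratio_density f lambda c E (t, z))%:E =
      pdf_D f lambda t)%E.
    rewrite /pdf_D [RHS]integral_mkcond; apply: eq_integral => z _.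
    rewrite patchE /ratio_density indicE/=; case: ifPn => /= z0.
      rewrite mem_set ?mulr1//; move: z0; rewrite inE/= in_itv/= andbT => z0.
      by split => //; rewrite /E/= rt// /q /p !posE.
    rewrite memNset ?mulr0// => -[[/= _ z0'] _].
    by move: z0; rewrite notin_setE/= in_itv/= z0'.
  rewrite GtE in Gt0 Gtoo *.
  have [I [mI I0 WI condI]] := cond_prob_closer_gt_half mf f0 lambda0 Gt0 Gtoo
    hW hWc t0 (hl _ t0) (psi0 _ t0) (psi100 _ t0)
    (fun m => @hlu lambda t m lambda1 t0)
    (hlow _ t0) (hhigh _ t0) (hmid _ t0) qpt.
  (* [I] lies in the slice of the event [A] intersected with [E], and it already carries more than
     half of [pdf_D]. *)
  apply: (@lt_le_trans _ _
      (\int[lebesgue_measure]_(s in I)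
         (s / lambda * f (s, s * t / lambda))%:E)%E).
    rewrite pdf_slice_cond// muleC lte_pmul2l//.
    by rewrite ge0_fin_numE// ltW.
  rewrite integral_mkcond; apply: ge0_le_integral => //.
  - move=> z _; apply: erestrict_ge0 => s /I0 /=; rewrite in_itv/= andbT => s0.
    by rewrite lee_fin pdf_slice_ge0// ltW.
  - apply/(measurable_restrictT _ mI); apply: measurable_funTS.
    by apply/measurable_EFinP; exact: measurable_pdf_slice.
  - by have /measurable_fun_pair2 := mk _ mAE; exact.
  move=> z _; rewrite patchE; case: ifPn => [|_]; last by rewrite lee_fin.
  rewrite inE => Iz; have /= := I0 _ Iz; rewrite in_itv/= andbT => z0.
  rewrite lee_fin /ratio_density indicE mem_set ?mulr1//=; split => //.
  split; last by rewrite /E/= rt// /q /p !posE.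
  rewrite /A/= /lossq /lossp/= rt// /q /p !posE//.
  rewrite (_ : c * z / c = z); last by field; rewrite gt_eqF.
  by rewrite /V !posE ?mulr_gt0 ?psi0 ?psi100//; exact: WI.
rewrite GPNE.
have AE : (P theta (X @^-1` (A `&` E)) <= P theta (X @^-1` A))%E.
  by apply: le_measure; rewrite ?inE; [exact: mX|exact: mX|move=> w []].
have CB : (P theta (X @^-1` (~` E)) <= P theta (X @^-1` B))%E.
  apply: le_measure; rewrite ?inE; [|exact: mX|].
    by apply: mX; exact: measurableC.
  by move=> w /= /negP/negPn/eqP; rewrite /B/= /lossq /lossp => ->.
have PEfin : P theta (X @^-1` E) \is a fin_num by rewrite ge0_fin_numE// ltW.
(* One half is split along [E]: [key] strictly beats the first term through [A], and the ties [B]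
   cover the second because both estimators agree off [E]. *)
have half : ((2^-1)%:E = (2^-1)%:E * P theta (X @^-1` E) +
    (2^-1)%:E * P theta (X @^-1` (~` E)))%E.
  rewrite PCE -(fineK PEfin) -EFinB -!EFinM -EFinD; congr EFin; ring.
rewrite {1}half; apply: lte_leD.
- by rewrite fin_numM// PCE fin_numB// PEfin.
- exact: lt_le_trans AE.
- by apply: lee_wpmul2l => //; rewrite lee_fin.
Qed.
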